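(* Let $\sigma$ be the $\mathbb{F}_5$-algebra automorphism of $A=\mathbb{F}_5[S_3]$ that fixes $I,(1\,2\,3),(1\,3\,2)$ and sends each transposition $\tau$ to $4\tau=-\tau$. Let $\mathcal{C}\subseteq\mathbb{F}_5[z]^6$ be a minimal $(S_3,\sigma)$-convolutional code such that $\rho_\sigma(\mathcal{C})\subseteq \mathcal{R}g_1$. Then $\mathcal{C}$ has rank $1$ over $\mathbb{F}_5[z]$, and there is a polynomial $f(z)=\sum_i a_i z^i\in\mathbb{F}_5[z]$ such that $\mathcal{C}$ has as $\mathbb{F}_5[z]$-basis one of the single vectors $$\bigl(f(z),\,f(-z),\,f(-z),\,f(-z),\,f(z),\,f(z)\bigr)$$ or $$\bigl(f(z),\,-f(-z),\,-f(-z),\,-f(-z),\,f(z),\,f(z)\bigr),$$ where either $\sum_i a_{2i}z^{2i}$ and $\sum_i a_{2i+1}z^{2i+1}$ are coprime (equivalently, $f(z)$ and $f(-z)$ are coprime), or $\sum_i a_{2i}z^{2i}=1$ and $\sum_i a_{2i+1}z^{2i+1}=0$. The complexity of $\mathcal{C}$ is $\deg f$.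
   Context: $\mathbb{F}_5$ is the field with 5 elements; the elements of the symmetric group $S_3$ are enumerated as $b_1=I$, $b_2=(1\,2)$, $b_3=(1\,3)$, $b_4=(2\,3)$, $b_5=(1\,2\,3)$, $b_6=(1\,3\,2)$. $\mathcal{R}=A[z;\sigma]$ is the skew polynomial ring whose elements are written uniquely as $\sum_j z^j a_j$ ($a_j\in A$), with multiplication determined by $az=z\sigma(a)$ for $a\in A$; it is a left $\mathbb{F}_5[z]$-module by left multiplication. The element $g_1=2\bigl(I+(1\,2\,3)+(1\,3\,2)\bigr)$ is the sum of the two central idempotents $f_1=\sum_{g\in S_3}g$ and $f_2=\sum_{g\in S_3}\mathrm{sgn}(g)g$ of $A$ (these are interchanged by $\sigma$), and $g_1$ is a central idempotent of $\mathcal{R}$; $\mathcal{R}=\mathcal{R}g_1\oplus\mathcal{R}g_2$ with $g_2=I-g_1$. A convolutional code of length $6$ is a direct summand $\mathcal{C}$ of the $\mathbb{F}_5[z]$-module $\mathbb{F}_5[z]^6$; its dimension $k$ is its rank. An encoder is a matrix whose $k$ rows form an $\mathbb{F}_5[z]$-basis of $\mathcal{C}$, and the complexity of $\mathcal{C}$ is the maximal degree of the $k\times k$ minors of an encoder. The left $\mathbb{F}_5[z]$-module isomorphism $\rho_\sigma:\mathbb{F}_5[z]^6\to\mathcal{R}$ sends $\sum_j z^j(w_{j1},\dots,w_{j6})$ (with $w_{ji}\in\mathbb{F}_5$) to $\sum_j z^j\sum_{i=1}^6 w_{ji}b_i$. A convolutional code $\mathcal{C}$ is an $(S_3,\sigma)$-convolutional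 code if $\rho_\sigma(\mathcal{C})$ is a left ideal of $\mathcal{R}$ that is a direct summand of $\mathcal{R}$ as a left $\mathcal{R}$-module; it is minimal if $\rho_\sigma(\mathcal{C})$ is indecomposable as a left $\mathcal{R}$-module. *)

(* Defs.v *)
From HB Require Import structures.
From mathcomp Require Import all_boot all_order all_fingroup all_algebra.
From mathcomp Require Import boolp classical_sets.

Set Implicit Arguments.
Unset Strict Implicit.
Unset Printing Implicit Defensive.

Import GRing.Theory.

Local Open Scope ring_scope.
Local Open Scope classical_set_scope.

(* [{ffun gT -> F}] already carries the pointwise product, so the group algebra
   is an alias that keeps the F-module structure and gets the convolution. *)
Section GroupAlgebra.

Variables (F : comNzRingType) (gT : finGroupType).

Definition groupalg : Type := {ffun gT -> F}.

HB.instance Definition _ :=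
  GRing.Lmodule.copy groupalg {ffun gT -> F^o}.

Implicit Types u v w : groupalg.

Definition gelt (g : gT) : groupalg := [ffun h => (h == g)%:R].

Definition gmul u v : groupalg :=
  [ffun g => \sum_(h : gT) u h * v (h^-1 * g)%g].

Fact gmulA : associative gmul.
Proof.
move=> u v w; apply/ffunP=> g; rewrite !ffunE.
under eq_bigr do rewrite ffunE mulr_sumr.
under [RHS]eq_bigr do rewrite ffunE mulr_suml.
rewrite [RHS]exchange_big /=; apply: eq_bigr => h _.
rewrite [RHS](reindex_inj (mulgI h)) /=; apply: eq_bigr => k _.
by rewrite mulrA mulKg invMg !mulgA.
Qed.

Fact gmul1l : left_id (gelt 1%g) gmul.
Proof.
move=> u; apply/ffunP=> g; rewrite ffunE (bigD1 1%g) //= ffunE eqxx mul1r.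
rewrite invg1 mul1g big1 ?addr0 // => h /negPf nh1.
by rewrite ffunE nh1 mul0r.
Qed.

Fact gmul1r : right_id (gelt 1%g) gmul.
Proof.
move=> u; apply/ffunP=> g; rewrite ffunE (bigD1 g) //= ffunE mulVg eqxx mulr1.
rewrite big1 ?addr0 // => h nhg; rewrite ffunE.
by rewrite -eq_mulVg1 (negPf nhg) mulr0.
Qed.

Fact gmulDl : left_distributive gmul +%R.
Proof.
move=> u v w; apply/ffunP=> g; rewrite !ffunE -big_split /=.
by apply: eq_bigr => h _; rewrite ffunE mulrDl.
Qed.

Fact gmulDr : right_distributive gmul +%R.
Proof.
move=> u v w; apply/ffunP=> g; rewrite !ffunE -big_split /=.
by apply: eq_bigr => h _; rewrite ffunE mulrDr.
Qed.

Fact gelt1_neq0 : gelt 1%g != 0.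
Proof.
apply/eqP=> /ffunP/(_ 1%g); rewrite !ffunE eqxx.
by apply/eqP; rewrite oner_eq0.
Qed.

HB.instance Definition _ := GRing.Zmodule_isNzRing.Build groupalg
  gmulA gmul1l gmul1r gmulDl gmulDr gelt1_neq0.

Fact gscaleAl (a : F) u v : a *: (u * v) = (a *: u) * v.
Proof.
apply/ffunP=> g; rewrite !ffunE /GRing.scale /= mulr_sumr.
by apply: eq_bigr => h _; rewrite ffunE mulrA.
Qed.

HB.instance Definition _ := GRing.Lmodule_isLalgebra.Build F groupalg gscaleAl.

Fact gscaleAr (a : F) u v : a *: (u * v) = u * (a *: v).
Proof.
apply/ffunP=> g; rewrite !ffunE /GRing.scale /= mulr_sumr.
by apply: eq_bigr => h _; rewrite ffunE mulrCA.
Qed.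

HB.instance Definition _ := GRing.Lalgebra_isAlgebra.Build F groupalg gscaleAr.

End GroupAlgebra.

(* The skew polynomial ring A[z; sigma].  The polynomial with coefficients
   (a_j) stands for \sum_j z^j a_j, coefficients on the right; since
   a z = z sigma(a), z^i a * z^j b = z^(i + j) sigma^j(a) b. *)
Definition skewpoly (A : nzRingType) (sigma : {rmorphism A -> A}) : Type :=
  {poly A}.
Arguments skewpoly {A} sigma.

Section SkewPolynomials.

Variables (A : nzRingType) (sigma : {rmorphism A -> A}).

HB.instance Definition _ := GRing.Zmodule.copy (skewpoly sigma) {poly A}.

Definition skewC (a : A) : skewpoly sigma := a%:P.

Definition skew_mul (p q : skewpoly sigma) : skewpoly sigma :=
  \poly_(n < (size (p : {poly A}) + size (q : {poly A})).-1)
    (\sum_(i < n.+1) iter (n - i) sigma (p : {poly A})`_i *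
                     (q : {poly A})`_(n - i)).

Fact iter_rmorph0 n : iter n sigma 0 = 0.
Proof. by elim: n => //= n ->; rewrite rmorph0. Qed.

Fact iter_rmorph1 n : iter n sigma 1 = 1.
Proof. by elim: n => //= n ->; rewrite rmorph1. Qed.

Fact iter_rmorphD n : {morph iter n sigma : x y / x + y}.
Proof. by move=> x y; elim: n => //= n ->; rewrite rmorphD. Qed.

Fact iter_rmorphM n : {morph iter n sigma : x y / x * y}.
Proof. by move=> x y; elim: n => //= n ->; rewrite rmorphM. Qed.

Fact iter_rmorph_sum n I (r : seq I) (P : pred I) (f : I -> A) :
  iter n sigma (\sum_(i <- r | P i) f i) =
  \sum_(i <- r | P i) iter n sigma (f i).
Proof. exact: (big_morph _ (iter_rmorphD n) (iter_rmorph0 n)). Qed.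

Fact coef_skew_mul (p q : skewpoly sigma) n :
  (skew_mul p q : {poly A})`_n =
  \sum_(i < n.+1) iter (n - i) sigma (p : {poly A})`_i *
                  (q : {poly A})`_(n - i).
Proof.
rewrite coef_poly ltn_predRL; case: leqP => // le_pq_n1.
rewrite big1 // => j _; have [lq_p_j|lt_j_p] := leqP (size (p : {poly A})) j.
  by rewrite nth_default ?iter_rmorph0 ?mul0r.
rewrite [(q : {poly A})`__]nth_default ?mulr0 // leq_subRL -ltnS //.
by rewrite (leq_trans _ le_pq_n1) // ltn_add2r.
Qed.

Fact coef_skew_mul_rev (p q : skewpoly sigma) n :
  (skew_mul p q : {poly A})`_n =
  \sum_(i < n.+1) iter i sigma (p : {poly A})`_(n - i) * (q : {poly A})`_i.
Proof.
rewrite coef_skew_mul (reindex_inj rev_ord_inj) /=.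
by apply: eq_bigr => j _; rewrite (sub_ordK j).
Qed.

Fact skew_mulA : associative skew_mul.
Proof.
move=> p q r; apply/polyP=> i; rewrite coef_skew_mul coef_skew_mul_rev.
pose coef3 j k := iter (i - j) sigma (p : {poly A})`_j *
  (iter k sigma (q : {poly A})`_(i - j - k) * (r : {poly A})`_k).
transitivity (\sum_(j < i.+1) \sum_(k < i.+1 | (k <= i - j)%N) coef3 j k).
  apply: eq_bigr => /= j _; rewrite coef_skew_mul_rev big_distrr /=.
  by rewrite (big_ord_narrow_leq (leq_subr _ _)).
rewrite (exchange_big_dep predT) //=; apply: eq_bigr => k _.
transitivity (\sum_(j < i.+1 | (j <= i - k)%N) coef3 j k).
  apply: eq_bigl => j; rewrite -ltnS -(ltnS j) -!subSn ?leq_ord //.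
  by rewrite -subn_gt0 -(subn_gt0 j) -!subnDA addnC.
rewrite (big_ord_narrow_leq (leq_subr _ _)) coef_skew_mul.
rewrite iter_rmorph_sum big_distrl /=.
apply: eq_bigr => j _; rewrite /coef3 iter_rmorphM -iterD mulrA /=.
have le_ji : (j <= i)%N := leq_trans (leq_ord j) (leq_subr k i).
have le_kij : (k <= i - j)%N.
  by rewrite leq_subRL // addnC -leq_subRL ?leq_ord // -ltnS.
by rewrite [(i - k - j)%N]subnAC subnKC.
Qed.

Fact skew_mul1l : left_id (skewC 1) skew_mul.
Proof.
move=> p; apply/polyP => i; rewrite coef_skew_mul big_ord_recl subn0.
rewrite coefC eqxx iter_rmorph1 mul1r big1 ?addr0 // => j _.
by rewrite coefC iter_rmorph0 mul0r.
Qed.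

Fact skew_mul1r : right_id (skewC 1) skew_mul.
Proof.
move=> p; apply/polyP => i; rewrite coef_skew_mul_rev big_ord_recl subn0.
rewrite coefC eqxx mulr1 big1 ?addr0 // => j _.
by rewrite coefC mulr0.
Qed.

Fact skew_mulDl : left_distributive skew_mul +%R.
Proof.
move=> p q r; apply/polyP=> i; rewrite coefD !coef_skew_mul -big_split.
by apply: eq_bigr => j _; rewrite coefD iter_rmorphD mulrDl.
Qed.

Fact skew_mulDr : right_distributive skew_mul +%R.
Proof.
move=> p q r; apply/polyP=> i; rewrite coefD !coef_skew_mul -big_split.
by apply: eq_bigr => j _; rewrite coefD mulrDr.
Qed.

Fact skewC1_neq0 : skewC 1 != 0.
Proof. by rewrite polyC_eq0 oner_neq0. Qed.

HB.instance Definition _ := GRing.Zmodule_isNzRing.Build (skewpoly sigma)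
  skew_mulA skew_mul1l skew_mul1r skew_mulDl skew_mulDr skewC1_neq0.

End SkewPolynomials.

Arguments skewC {A} sigma a.

Section Modules.

Variables (R : nzRingType) (M : lmodType R).
Implicit Types L : set M.

Definition submodule L : Prop :=
  L 0 /\ forall (a : R) (x y : M), L x -> L y -> L (a *: x + y).

(* L is the internal direct sum of L1 and L2 *)
Definition direct_sum L L1 L2 : Prop :=
  [/\ submodule L1, submodule L2, L1 `&` L2 = [set 0]
    & L = [set x + y | x in L1 & y in L2]].

Definition direct_summand L : Prop := exists L', direct_sum setT L L'.

(* the zero module is not indecomposable *)
Definition indecomposable L : Prop :=
  [/\ submodule L, L <> [set 0]
    & forall L1 L2, direct_sum L L1 L2 -> L1 = [set 0] \/ L2 = [set 0]].

End Modules.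

Section ConvolutionalCodes.

Variables (F : fieldType) (n : nat).
Implicit Types C : set 'rV[{poly F}]_n.

Definition conv_code C : Prop := submodule C /\ direct_summand C.

(* the rows of G form a basis of C *)
Definition encoder C k (G : 'M[{poly F}]_(k, n)) : Prop :=
  injective (fun u : 'rV[{poly F}]_k => u *m G) /\
  C = range (fun u : 'rV[{poly F}]_k => u *m G).

Definition has_rank C k : Prop :=
  exists G : 'M[{poly F}]_(k, n), encoder C G.

(* Minors differing by a permutation of the columns agree up to sign, so all
   injective choices of columns may be used.  The zero minor contributes 0. *)
Definition max_minor_degree k (G : 'M[{poly F}]_(k, n)) : nat :=
  \max_(h : {ffun 'I_k -> 'I_n} | injectiveb h) (size (\det (colsub h G))).-1.

(* The degree does not depend on the encoder, which is part of the claim. *)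
Definition has_complexity C (d : nat) : Prop :=
  (exists k, has_rank C k) /\
  forall k (G : 'M[{poly F}]_(k, n)), encoder C G -> max_minor_degree G = d.

End ConvolutionalCodes.

(* The letters 1, 2, 3 are the elements 0, 1, 2 of 'I_3. *)
Definition cycle123 : 'S_3 := perm (@ordS_inj 3).

(* I, (1 2), (1 3), (2 3), (1 2 3), (1 3 2) *)
Definition S3_enum : 6.-tuple 'S_3 :=
  [tuple 1%g; tperm 0 1; tperm 0 2; tperm 1 2; cycle123; cycle123^-1%g].

Definition F5S3 := groupalg 'F_5 'S_3.

Definition g1 : F5S3 :=
  2 *: (gelt 'F_5 1%g + gelt 'F_5 cycle123 + gelt 'F_5 cycle123^-1%g).

Section GroupCodes.

Variable sigma : {rmorphism F5S3 -> F5S3}.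
Implicit Types C : set 'rV[{poly 'F_5}]_6.

Definition rho (v : 'rV[{poly 'F_5}]_6) : skewpoly sigma :=
  \sum_(i < 6) map_poly (fun a : 'F_5 => a *: gelt 'F_5 (tnth S3_enum i)) (v 0 i).

(* the image of C, in the ring A[z; sigma] seen as a left module over itself *)
Definition rho_image C : set (skewpoly sigma)^o := [set rho v | v in C].

Definition Rg1 : set (skewpoly sigma)^o :=
  range (fun x : skewpoly sigma => x * skewC sigma g1).

Definition group_conv_code C : Prop :=
  [/\ conv_code C, submodule (rho_image C) & direct_summand (rho_image C)].

Definition minimal_group_conv_code C : Prop :=
  group_conv_code C /\ indecomposable (rho_image C).

End GroupCodes.

Arguments rho_image sigma C : clear implicits.
Arguments Rg1 sigma : clear implicits.

Section Vectors.

Variable f : {poly 'F_5}.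

(* \sum_i a_(2i) z^(2i) and \sum_i a_(2i+1) z^(2i+1); these are not the
   library's [even_poly] and [odd_poly], which compress the exponents *)
Definition even_part : {poly 'F_5} :=
  \sum_(i < size f | ~~ odd i) f`_i *: 'X^i.
Definition odd_part : {poly 'F_5} :=
  \sum_(i < size f | odd i) f`_i *: 'X^i.

Definition fneg : {poly 'F_5} := f \Po (- 'X).

Definition vec_plus : 'rV[{poly 'F_5}]_6 :=
  \row_i [:: f; fneg; fneg; fneg; f; f]`_i.
Definition vec_minus : 'rV[{poly 'F_5}]_6 :=
  \row_i [:: f; - fneg; - fneg; - fneg; f; f]`_i.

End Vectors.

(* Main.v *)
Require Import Defs.
From mathcomp Require Import all_boot all_order all_fingroup all_algebra.
From mathcomp Require Import boolp classical_sets ring.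

(** Write F for the field with 5 elements, e for the sum of the even
permutations and t for the sum of the transpositions.  The ideal of A generated
by g1 is F e + F t, so the codes in question consist of block vectors
(a, b, b, b, a, a), whose image under rho is a e + b t: they are submodules of
the free F[z]-module of rank 2.

A direct summand is saturated, so by [saturated_plane] it is zero, or the whole
plane, or F[z](a, b) with a and b coprime.  The zero module is not
indecomposable.  Neither is the whole plane: right multiplication by (1 2) is an
involution of the left module R g1 that exchanges e and t
([rho_blockvec_t12]), and since 2 is invertible R g1 is the direct sum of its
two eigenspaces ([involution_direct_sum]), which are generated by the
idempotents f1 = e + t and f2 = e - t.  Hence the code is F[z](a, b).

Being a left ideal, its image is stable under left multiplication by (1 2).
Since (1 2) z = - z (1 2), this maps (a(z), b(z)) to (b(-z), a(-z))
([t12_rho_blockvec]).  On a module of rank 1 the map must multiply the generator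
by some k in F[z]; applying it twice gives k(-z) k(z) = 1, so k = 1 or k = -1
and b(z) is a(-z) or - a(-z) ([fneg_swap]).  Thus f = a works, the coprimality
of f(z) and f(-z) being that of a and b.  Any two bases of the code differ by a
unit of F[z], and all entries of this one have the degree of f, which is
therefore the complexity. *)

Import GRing.Theory.

Local Open Scope ring_scope.
Local Open Scope classical_set_scope.

(** * Saturated submodules and codes of rank 1 *)

Section Lattices.
Variable F : fieldType.

(** A nonzero pair in D divided by its gcd stays in D, which yields a coprime
pair (a, b).  If some (c, d) in D is independent of it, Cramer's rule puts a
nonzero multiple of every pair in D; otherwise a Bezout relation
u a + v b = 1 gives (c, d) = (u c + v d) (a, b). *)
Lemma saturated_plane (D : {poly F} -> {poly F} -> Prop)
  (D_lin : forall k a b c d, D a b -> D c d -> D (k * a + c) (k * b + d))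
  (D_sat : forall k a b, k != 0 -> D (k * a) (k * b) -> D a b) :
  [\/ forall a b, D a b -> a = 0 /\ b = 0,
      forall a b, D a b
    | exists a b, [/\ coprimep a b, D a b
        & forall c d, D c d -> exists k, c = k * a /\ d = k * b]].
Proof.
have [[a0 [b0 [Dab0 nz]]]|Dtriv] :=
  EM (exists a b, D a b /\ (a != 0) || (b != 0)); last first.
  apply: Or31 => a b Dab; apply: contrapT => nz; apply: Dtriv.
  exists a, b; split=> //; rewrite -negb_and; apply/negP => /andP[/eqP az /eqP bz].
  exact: nz.
have [a [b [Dab cop_ab]]] : exists a b, D a b /\ coprimep a b.
  exists (a0 %/ gcdp a0 b0), (b0 %/ gcdp a0 b0); split; last first.
    by rewrite coprimep_div_gcd.
  apply: (D_sat (gcdp a0 b0)); first by rewrite gcdp_eq0 negb_and.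
  by rewrite ![gcdp a0 b0 * _]mulrC !divpK ?dvdp_gcdl ?dvdp_gcdr.
have D00 : D 0 0.
  by have := D_lin (-1) a b a b Dab Dab; rewrite !mulN1r !addNr.
have [[c [d [Dcd nz_det]]]|dep] := EM (exists c d, D c d /\ a * d - b * c != 0).
  (* Cramer: det (x, y) = (x d - y c) (a, b) + (a y - b x) (c, d) *)
  apply: Or32 => x y; apply: (D_sat _ _ _ nz_det).
  have := D_lin (x * d - y * c) _ _ _ _ Dab
            (D_lin (a * y - b * x) _ _ _ _ Dcd D00).
  by congr (D _ _); ring.
apply: Or33; exists a, b; split=> // c d Dcd.
have {dep} ad_bc : a * d = b * c.
  apply/eqP; rewrite -subr_eq0; apply/negP => nz'; apply: dep.
  by exists c, d; split=> //; apply/negP.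
have [[u v] /= uv1] := Bezout_eq1_coprimepP _ _ cop_ab.
exists (u * c + v * d); split.
  transitivity ((u * a + v * b) * c); first by rewrite uv1 mul1r.
  by rewrite !mulrDl -[v * b * c]mulrA -ad_bc; ring.
transitivity ((u * a + v * b) * d); first by rewrite uv1 mul1r.
by rewrite !mulrDl -[u * a * d]mulrA ad_bc; ring.
Qed.

Lemma summand_saturated n (C : set 'rV[{poly F}]_n) k v :
  direct_summand C -> k != 0 -> C (k *: v) -> C v.
Proof.
move=> [C' [[C0 Clin] [C'0 C'lin] CC' sumCC']] k_neq0 Ckv.
have [x Cx [y C'y xyv]] : [set x + y | x in C & y in C'] v.
  by rewrite -sumCC'.
have ky0 : k *: y = 0.
  suff : (C `&` C') (k *: y) by rewrite CC'.
  split; last by rewrite -[_ *: y]addr0; apply: C'lin.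
  have -> : k *: y = - k *: x + k *: v by rewrite -xyv scalerDr scaleNr addKr.
  exact: Clin.
suff -> : v = x by [].
rewrite -xyv; suff -> : y = 0 by rewrite addr0.
apply/rowP=> i; move/rowP/(_ i): ky0; rewrite !mxE => /eqP.
by rewrite mulf_eq0 (negPf k_neq0) => /eqP.
Qed.

Lemma encoder_row n (C : set 'rV[{poly F}]_n) (v : 'rV[{poly F}]_n) :
  v != 0 -> encoder C v <-> C = range (fun k => k *: v).
Proof.
move=> v_neq0.
have mulv (u : 'rV[{poly F}]_1) : u *m v = u 0 0 *: v.
  by rewrite [u in LHS]mx11_scalar mul_scalar_mx.
have -> : range (fun k => k *: v) = range (fun u : 'rV[{poly F}]_1 => u *m v).
  rewrite eqEsubset; split=> _ [k _ <-] /=.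
    by exists k%:M => //; rewrite mulv mxE eqxx.
  by exists (k 0 0) => //; rewrite mulv.
split=> [[]//|->]; split=> // u w; rewrite !mulv => /eqP.
have [j vj] : exists j, v 0 j != 0.
  apply: contrapT => nex; move/eqP: v_neq0; apply; apply/rowP=> j; rewrite mxE.
  by apply/eqP; apply: contrapT => vj; apply: nex; exists j; apply/negP.
move=> /eqP/rowP/(_ j); rewrite !mxE => /(mulIf vj) uw.
by rewrite [u]mx11_scalar [w]mx11_scalar uw.
Qed.

(** Two bases v and G of the same module are related by G = V v and v = w G.
Then V w = 1 and w V = 1, which forces G to have a single row and V to be a
nonzero constant, so that the degrees of the entries agree. *)
Lemma encoder_rank1_minors n (C : set 'rV[{poly F}]_n) (v : 'rV[{poly F}]_n)
    k (G : 'M[{poly F}]_(k, n)) :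
  encoder C v -> encoder C G ->
  max_minor_degree G = \max_(j < n) (size (v 0%R j)).-1.
Proof.
move=> [v_inj Cv] [G_inj CG].
have [V GV] : exists V : 'cV[{poly F}]_k, G = V *m v.
  have row_span i : exists u : 'rV[{poly F}]_1, u *m v = row i G.
    have : C (row i G) by rewrite CG; exists (delta_mx 0 i); rewrite // -rowE.
    by rewrite Cv => -[u _]; exists u.
  have [V HV] := boolp.choice row_span.
  exists (\matrix_i V i); apply/row_matrixP => i.
  by rewrite row_mul rowK HV.
have [w wG] : exists w : 'rV[{poly F}]_k, w *m G = v.
  have : C v by rewrite Cv; exists 1%:M; rewrite // mul1mx.
  by rewrite CG => -[w _]; exists w.
have Vw1 : V *m w = 1%:M.
  apply/row_matrixP => i; apply: G_inj.
  by rewrite -!row_mul mul1mx -mulmxA wG -GV.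
have wV1 : w *m V = 1%:M by apply: v_inj; rewrite -mulmxA -GV wG mul1mx.
have k1 : k = 1%N by apply/eqP; rewrite eqn_leq (mulmx1_min Vw1) (mulmx1_min wV1).
subst k.
have V_unit : V 0 0 \is a GRing.unit.
  apply/unitrPr; exists (w 0 0).
  by move/matrixP/(_ 0 0): Vw1; rewrite !mxE big_ord1.
have sizeG j : size (G 0 j) = size (v 0 j).
  move: V_unit; rewrite poly_unitE => /andP[/size_poly1P[c c_neq0 Vc] _].
  by rewrite GV mxE big_ord1 Vc mul_polyC size_scale.
rewrite /max_minor_degree; apply/eqP; rewrite eqn_leq; apply/andP; split.
  apply/bigmax_leqP => h _; rewrite det_mx11 !mxE sizeG.
  exact: (leq_bigmax (h 0)).
apply/bigmax_leqP => j _.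
have h_inj : injectiveb [ffun _ : 'I_1 => j].
  by apply/injectiveP => x y _; rewrite !ord1.
apply: leq_trans (leq_bigmax_cond _ h_inj).
by rewrite det_mx11 !mxE ffunE sizeG.
Qed.

End Lattices.

(** * Splitting a left ideal along an involution *)

Section Involution.
Variable R : nzRingType.

(** Right multiplications are endomorphisms of left modules, so the eigenspaces
of an involutive one are submodules; x is the sum of its projections
(x + x s) / 2 and (x - x s) / 2. *)
Lemma involution_direct_sum (half s : R) (L : set R^o) :
  half *+ 2 = 1 -> submodule L ->
  (forall x : R, L x -> L (x * s)) -> (forall x : R, L x -> x * s * s = x) ->
  direct_sum L [set x : R | L x /\ x * s = x] [set x : R | L x /\ x * s = - x].
Proof.
move=> half2 [L0 Llin] Ls Lss.
have halfD (x : R) : half * x + half * x = x.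
  by rewrite -mulrDl -mulr2n half2 mul1r.
split.
- split=> [|a x y [Lx xs] [Ly ys]]; first by rewrite /= mul0r.
  split; first exact: Llin.
  by rewrite mulrDl /GRing.scale /= -mulrA xs ys.
- split=> [|a x y [Lx xs] [Ly ys]]; first by rewrite /= mul0r oppr0.
  split; first exact: Llin.
  by rewrite mulrDl /GRing.scale /= -mulrA xs ys mulrN opprD.
- rewrite eqEsubset; split=> [x [[_ xs] [_]]|_ ->]; last first.
    by split; split; rewrite ?mul0r ?oppr0.
  rewrite xs => xN /=; rewrite -[x]halfD [in X in _ + X]xN mulrN.
  exact: subrr.
have Lcomb (x : R) (a b : R) : L x -> L (a * x + b * (x * s)).
  move=> Lx; apply: (Llin a) => //; rewrite -[b * _]addr0; apply: (Llin b) => //.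
  exact: Ls.
rewrite eqEsubset; split=> [x Lx|_ [x [Lx _] [y [Ly _] <-]]]; last first.
  by rewrite -[x]scale1r; apply: Llin.
exists (half * x + half * (x * s)).
  split; first exact: Lcomb.
  by rewrite mulrDl -!mulrA [x * (s * s)]mulrA Lss // addrC.
exists (half * x - half * (x * s)).
  rewrite -mulNr; split; first exact: Lcomb.
  by rewrite mulrDl -!mulrA [x * (s * s)]mulrA Lss // !mulNr opprD opprK addrC.
by rewrite addrACA subrr addr0; apply: halfD.
Qed.

End Involution.

(** * The substitution of - z for z *)

Lemma size_fneg f : size (fneg f) = size f.
Proof. by rewrite size_comp_poly2 // size_polyN size_polyX. Qed.

Lemma fnegM f g : fneg (f * g) = fneg f * fneg g.
Proof. exact: comp_polyM. Qed.

Lemma fnegK : involutive fneg.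
Proof.
move=> f; rewrite /fneg -comp_polyA.
by rewrite raddfN /= comp_polyX opprK comp_polyXr.
Qed.

Lemma coef_fneg f n : (fneg f)`_n = (-1) ^+ n * f`_n.
Proof.
rewrite coef_comp_poly.
under eq_bigr => i _ do rewrite exprNn -signr_odd -polyC1 -polyCN -polyC_exp
  coefCM coefXn signr_odd.
have [lt_n|le_n] := ltnP n (size f).
  rewrite (bigD1 (Ordinal lt_n)) //= eqxx mulr1 mulrC big1 ?addr0 // => i.
  by rewrite -val_eqE /= eq_sym => /negPf ->; rewrite !mulr0.
rewrite (nth_default _ le_n) mulr0 big1 // => i _.
by rewrite gtn_eqF ?mulr0 // (leq_trans (ltn_ord i)).
Qed.

Lemma even_odd_part f : f = even_part f + odd_part f.
Proof.
rewrite -[LHS]coefK poly_def (bigID (fun i : 'I_ _ => odd i)) /= addrC.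
by [].
Qed.

Lemma fneg_even_odd f : fneg f = even_part f - odd_part f.
Proof.
rewrite /fneg comp_polyE (bigID (fun i : 'I_ _ => odd i)) /= addrC.
congr (_ + _).
  by apply: eq_bigr => i /negPf ev; rewrite exprNn -signr_odd ev mul1r.
rewrite -sumrN; apply: eq_bigr => i od.
by rewrite exprNn -signr_odd od mulN1r scalerN.
Qed.

(** If p and q are the even and odd parts, f = p + q and f(-z) = p - q
generate the same ideal as p and q, because 2 is invertible. *)
Lemma coprimep_even_odd f :
  coprimep (even_part f) (odd_part f) = coprimep f (fneg f).
Proof.
rewrite fneg_even_odd; have := even_odd_part f.
move: (even_part f) (odd_part f) => p q ->.
have -> : p - q = -1 * (p + q) + 2 *: p.
  by rewrite scaler_nat mulN1r opprD mulr2n addrACA addNr add0r addrC.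
rewrite coprimep_addl_mul coprimepZr // [RHS]coprimep_sym.
by rewrite -[p in p + q]mul1r coprimep_addl_mul.
Qed.

(** The semilinear involution (a, b) |-> (b(-z), a(-z)) fixes the line spanned
by (a, b), with multiplier k.  Its square is the identity, so k(-z) k(z) = 1
thanks to the Bezout relation for a and b; hence k is constant and its square
is 1. *)
Lemma fneg_swap a b k : coprimep a b ->
  fneg b = k * a -> fneg a = k * b -> b = fneg a \/ b = - fneg a.
Proof.
move=> cop_ab bka akb.
have kk (c : {poly 'F_5}) d : fneg d = k * c -> fneg c = k * d ->
    (fneg k * k) * c = c.
  by move=> dc cd; rewrite -mulrA -dc -fnegM -cd fnegK.
have kk1 : fneg k * k = 1.
  have [[u v] /= uv1] := Bezout_eq1_coprimepP _ _ cop_ab.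
  rewrite -[LHS]mulr1 -uv1 mulrDr !(mulrCA _ u) !(mulrCA _ v).
  by rewrite (kk a b) // (kk b a).
have : k \is a GRing.unit by apply/unitrPr; exists (fneg k); rewrite mulrC.
rewrite poly_unitE => /andP[/size_poly1P[c _ kc] _].
have fk : fneg k = k by rewrite kc /fneg comp_polyC.
have /eqP : k ^+ 2 = 1 by rewrite expr2 -{1}fk.
have {bka}-> : b = k * fneg a by rewrite -[LHS]fnegK bka fnegM fk.
rewrite -subr_eq0 subr_sqr_1 mulf_eq0 subr_eq0 addr_eq0.
by case/orP=> /eqP ->; [left; rewrite mul1r | right; rewrite mulN1r].
Qed.

(** * The symmetric group of degree 3 and its group algebra *)

Local Notation t12 := (tperm 0 1 : 'S_3).
Local Notation t13 := (tperm 0 2 : 'S_3).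
Local Notation t23 := (tperm 1 2 : 'S_3).

Ltac S3_eq := let i := fresh "i" in apply/permP => i; rewrite !permM;
  case: i => [[|[|[|//]]] ?]; rewrite !permE /=; apply/val_inj;
  rewrite ?permE /=; reflexivity.

Lemma cycle123_sqr : (cycle123 * cycle123)%g = cycle123^-1%g.
Proof.
apply: (mulIg cycle123); rewrite mulVg; apply/permP => i; rewrite !permM.
by case: i => [[|[|[|//]]] ?]; rewrite !permE; apply/val_inj.
Qed.

Lemma t12_cycle : (t12 * cycle123)%g = t13. Proof. S3_eq. Qed.

Lemma cycle_t12 : (cycle123 * t12)%g = t23. Proof. S3_eq. Qed.

Lemma t12_cycleV : (t12 * cycle123^-1)%g = t23.
Proof. by apply: invg_inj; rewrite invMg invgK !tpermV cycle_t12. Qed.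

Lemma cycleV_t12 : (cycle123^-1 * t12)%g = t13.
Proof. by apply: invg_inj; rewrite invMg invgK !tpermV t12_cycle. Qed.

Lemma S3_enum_uniq : uniq S3_enum.
Proof.
rewrite [tval S3_enum]/= -cycle123_sqr.
(* a permutation is told apart by its list of values *)
apply: (@map_uniq _ _ (fun s : 'S_3 => [seq val (s i) | i <- [:: 0; 1; 2]])).
by rewrite /= !permE /= !permE.
Qed.

Section GroupAlgebraTheory.
Variables (F : comNzRingType) (gT : finGroupType).

Lemma gelt_mul (g h : gT) : gelt F g * gelt F h = gelt F (g * h)%g.
Proof.
apply/ffunP=> x; rewrite !ffunE (bigD1 g) //= !ffunE eqxx mul1r.
rewrite big1 ?addr0 => [|y /negPf ny]; last by rewrite ffunE ny mul0r.
by rewrite -(inj_eq (mulgI g)) mulKVg.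
Qed.

Lemma mul_gelt_r (u : groupalg F gT) (g x : gT) :
  (u * gelt F g) x = u (x * g^-1)%g.
Proof.
rewrite ffunE (bigD1 (x * g^-1)%g) //= ffunE invMg invgK mulgKV eqxx mulr1.
rewrite big1 ?addr0 // => y ny; rewrite ffunE.
case: eqP => [yxg|]; last by rewrite mulr0.
by case/eqP: ny; rewrite -yxg invMg invgK mulKVg.
Qed.

Lemma groupalg_sumE I (r : seq I) (P : pred I) (f : I -> groupalg F gT) x :
  (\sum_(i <- r | P i) f i) x = \sum_(i <- r | P i) f i x.
Proof.
by apply: (big_morph (fun u : groupalg F gT => u x)) => [u v|]; rewrite ffunE.
Qed.

Lemma groupalg_scaleE (a : F) (u : groupalg F gT) x : (a *: u) x = a * u x.
Proof. by rewrite ffunE. Qed.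

Lemma geltE (g h : gT) : gelt F g h = (h == g)%:R.
Proof. by rewrite ffunE. Qed.

End GroupAlgebraTheory.

(** * Multiplication by constants in the skew polynomial ring *)

Section SkewConstants.
Variables (A : nzRingType) (sigma : {rmorphism A -> A}).
Implicit Types p : skewpoly sigma.

Lemma coef_skewC_mul (a : A) p n :
  (skewC sigma a * p : {poly A})`_n = iter n sigma a * (p : {poly A})`_n.
Proof.
rewrite coef_skew_mul big_ord_recl subn0 coefC eqxx big1 ?addr0 // => i _.
by rewrite coefC iter_rmorph0 mul0r.
Qed.

Lemma coef_mul_skewC p (a : A) n :
  (p * skewC sigma a : {poly A})`_n = (p : {poly A})`_n * a.
Proof.
rewrite coef_skew_mul_rev big_ord_recl subn0 coefC eqxx big1 ?addr0 // => i _.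
by rewrite coefC mulr0.
Qed.

End SkewConstants.

(** * Block vectors and their images *)

(** The vectors corresponding to the elements of R g1. *)
Definition blockvec (R : nmodType) (a b : R) : 'rV[R]_6 :=
  \row_i [:: a; b; b; b; a; a]`_i.

Arguments blockvec {R} a b.

Lemma blockvec_lin (R : nzRingType) (k a b c d : R) :
  blockvec (k * a + c) (k * b + d) = k *: blockvec a b + blockvec c d.
Proof.
by apply/rowP=> -[[|[|[|[|[|[|//]]]]]] ?]; rewrite !mxE.
Qed.

Lemma blockvecZ (R : nzRingType) (k a b : R) :
  k *: blockvec a b = blockvec (k * a) (k * b).
Proof.
by apply/rowP=> -[[|[|[|[|[|[|//]]]]]] ?]; rewrite !mxE.
Qed.

(** The next three identities are applied to the concrete group algebra as a
whole, which avoids rewriting by ring laws inside it: there unification would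
unfold the field and the group. *)
Lemma sum_block_terms (R : nzRingType) (V : lmodType R) (a b : R) (x y z u v w : V) :
  a *: x + (b *: u + (b *: v + (b *: w + (a *: y + (a *: z + 0))))) =
  a *: (x + y + z) + b *: (u + v + w).
Proof.
rewrite !scalerDr addr0 -!addrA; congr (_ + _).
by rewrite [RHS]addrA [RHS]addrC -!addrA.
Qed.

Lemma lincomb_mul (R : nzRingType) (A : lalgType R) (a b : R) (x y t : A) :
  (a *: x + b *: y) * t = a *: (x * t) + b *: (y * t).
Proof. by rewrite mulrDl !scalerAl. Qed.

Lemma mul_lincomb (R : comNzRingType) (A : algType R) (c a b : R) (x y t : A) :
  (c *: t) * (a *: x + b *: y) = (c * a) *: (t * x) + (c * b) *: (t * y).
Proof. by rewrite mulrDr -!scalerAl -!scalerAr !scalerA. Qed.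

Section Rho.
Variable sigma : {rmorphism F5S3 -> F5S3}.
Local Notation gel g := (gelt 'F_5 g).

(** The elements e and t: [g1] is twice [even_sum]. *)
Definition even_sum : F5S3 := gel 1%g + gel cycle123 + gel cycle123^-1%g.
Definition odd_sum : F5S3 := gel t12 + gel t13 + gel t23.

Lemma t12_even_sum : gel t12 * even_sum = odd_sum.
Proof.
by rewrite !mulrDr !gelt_mul mulg1 t12_cycle t12_cycleV.
Qed.

Lemma even_sum_t12 : even_sum * gel t12 = odd_sum.
Proof.
by rewrite !mulrDl !gelt_mul mul1g cycle_t12 cycleV_t12 addrAC.
Qed.

Lemma t12_odd_sum : gel t12 * odd_sum = even_sum.
Proof. by rewrite -t12_even_sum mulrA gelt_mul tperm2 mul1r. Qed.

Lemma odd_sum_t12 : odd_sum * gel t12 = even_sum.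
Proof. by rewrite -even_sum_t12 -mulrA gelt_mul tperm2 mulr1. Qed.

Lemma coef_rho v n : (rho sigma v : {poly F5S3})`_n =
  \sum_(i < 6) (v 0 i)`_n *: gel (tnth S3_enum i).
Proof.
rewrite coef_sum; apply: eq_bigr => i _.
by rewrite coef_map_id0 ?scale0r.
Qed.

(** Fixing the field and the group keeps unification fast. *)
Lemma F5S3_scaleE (a : 'F_5) (u : F5S3) x : (a *: u) x = a * u x.
Proof. exact: groupalg_scaleE. Qed.

Lemma coef_rho_at v n i :
  (rho sigma v : {poly F5S3})`_n (tnth S3_enum i) = (v 0 i)`_n.
Proof.
rewrite coef_rho groupalg_sumE (bigD1 i) //=.
rewrite [X in X + _]F5S3_scaleE [X in _ * X]geltE eqxx [X in X + _]mulr1.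
rewrite big1 => [|j nji]; first exact: addr0.
rewrite [LHS]F5S3_scaleE [X in _ * X]geltE.
rewrite (tnth_nth 1%g) [tnth _ j](tnth_nth 1%g).
rewrite nth_uniq ?S3_enum_uniq ?size_tuple // eq_sym.
by rewrite (negPf (nji : (j : nat) != i)) [LHS]mulr0.
Qed.

Lemma rho_inj : injective (rho sigma).
Proof.
move=> u v uv; apply/rowP=> i; apply/polyP=> n.
by rewrite -!coef_rho_at uv.
Qed.

Lemma coef_rho_blockvec a b n :
  (rho sigma (blockvec a b) : {poly F5S3})`_n =
  a`_n *: even_sum + b`_n *: odd_sum.
Proof.
rewrite coef_rho !big_ord_recl big_ord0 !mxE /= !(tnth_nth 1%g) /=.
exact: sum_block_terms.
Qed.

Lemma rho_blockvec_t12 a b :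
  rho sigma (blockvec a b) * skewC sigma (gel t12) = rho sigma (blockvec b a).
Proof.
apply/polyP => n; rewrite coef_mul_skewC.
rewrite [RHS]coef_rho_blockvec [X in X * _]coef_rho_blockvec.
rewrite [LHS]lincomb_mul even_sum_t12 odd_sum_t12; exact: addrC.
Qed.

(** Moving (1 2) across the power z ^ n multiplies it by (-1) ^ n, which turns
each coefficient polynomial into its value at - z, while (1 2) exchanges the
two sums. *)
Lemma t12_rho_blockvec (sigma_t12 : sigma (gel t12) = - gel t12) a b :
  skewC sigma (gel t12) * rho sigma (blockvec a b) =
  rho sigma (blockvec (fneg b) (fneg a)).
Proof.
have iter_t12 n : iter n sigma (gel t12) = (-1) ^+ n *: gel t12.
  elim: n => [|n /= ->]; first by rewrite expr0 scale1r.
  rewrite -signr_odd exprS -[in RHS]signr_odd; case: (odd n).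
    rewrite expr1 mulN1r opprK scaleN1r scale1r rmorphN sigma_t12; exact: opprK.
  by rewrite expr0 mulr1 scaleN1r scale1r sigma_t12.
apply/polyP => n; rewrite coef_skewC_mul.
rewrite [RHS]coef_rho_blockvec [X in _ * X]coef_rho_blockvec iter_t12.
rewrite [LHS]mul_lincomb !coef_fneg t12_even_sum t12_odd_sum; exact: addrC.
Qed.

Lemma rho_blockvecN a b :
  rho sigma (blockvec (- a) (- b)) = - rho sigma (blockvec a b).
Proof.
apply/polyP => n; rewrite coefN.
rewrite [LHS]coef_rho_blockvec [X in _ = - X]coef_rho_blockvec !coefN.
by rewrite !scaleNr opprD.
Qed.

Lemma rho0 : rho sigma 0 = 0.
Proof.
by rewrite /rho big1 // => i _; rewrite mxE; apply: map_poly0.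
Qed.

(** Since g1 (1 2 3) = g1, the coefficients of an element of R g1 are constant
on the left cosets of the subgroup generated by (1 2 3), which are the even
and the odd permutations. *)
Lemma rho_Rg1 v : Rg1 sigma (rho sigma v) ->
  v = blockvec (v 0 0) (v 0 1).
Proof.
case=> x _ xv.
have g1_cycle : g1 * gel cycle123 = g1.
  rewrite /g1 -scalerAl !mulrDl !gelt_mul mul1g cycle123_sqr mulVg.
  by rewrite addrC addrA.
have coef_cycle n g : (rho sigma v : {poly F5S3})`_n (g * cycle123)%g =
                      (rho sigma v : {poly F5S3})`_n g.
  have xvn : (rho sigma v : {poly F5S3})`_n = (x : {poly F5S3})`_n * g1.
    by rewrite -xv; exact: coef_mul_skewC.
  have {1}-> : (rho sigma v : {poly F5S3})`_n =
               (rho sigma v : {poly F5S3})`_n * gel cycle123.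
    by rewrite xvn -[RHS]mulrA g1_cycle.
  by rewrite [LHS]mul_gelt_r mulgK.
have eqv i j : (tnth S3_enum i * cycle123)%g = tnth S3_enum j -> v 0 i = v 0 j.
  move=> ij; apply/polyP => n; rewrite -!coef_rho_at -ij; exact/esym/coef_cycle.
have v04 : v 0 0 = v 0 4 by apply: eqv; rewrite !(tnth_nth 1%g) /= mul1g.
have v45 : v 0 4 = v 0 5 by apply: eqv; rewrite !(tnth_nth 1%g) /= cycle123_sqr.
have v12 : v 0 1 = v 0 2 by apply: eqv; rewrite !(tnth_nth 1%g) /= t12_cycle.
have v31 : v 0 3 = v 0 1.
  by apply: eqv; rewrite !(tnth_nth 1%g) /= -t12_cycleV mulgKV.
have vE (i j : 'I_6) : val i = val j -> v 0 i = v 0 j by move=> /val_inj ->.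
apply/rowP => i; rewrite mxE; case: i => -[|[|[|[|[|[|//]]]]]] lt_i /=.
- exact: vE.
- exact: vE.
- by rewrite v12; apply: vE.
- by rewrite -v31; apply: vE.
- by rewrite v04; apply: vE.
- by rewrite v04 v45; apply: vE.
Qed.

End Rho.

(** * Minimal codes *)

(** The element 3 is the inverse of 2 in characteristic 5. *)
Lemma skewpoly_half (sigma : {rmorphism F5S3 -> F5S3}) :
  (1 *+ 3 *+ 2 : skewpoly sigma) = 1.
Proof.
have F5S3_6 (u : F5S3) : u *+ 6 = u.
  have six : (6%:R : 'F_5) = 1 by apply/val_inj.
  by rewrite -[LHS]scaler_nat six scale1r.
rewrite -mulrnA; apply/polyP => n; rewrite coefMn; exact: F5S3_6.
Qed.

Lemma max_deg_blockvec (a b : {poly 'F_5}) : size b = size a ->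
  \max_(j < 6) (size (blockvec a b 0%R j)).-1 = (size a).-1.
Proof.
by move=> ba; rewrite !big_ord_recl big_ord0 !mxE /= ba maxn0 !maxnn.
Qed.

Theorem mainTheorem3
  (sigma : {lrmorphism F5S3 -> F5S3})
  (sigma_bij : bijective sigma)
  (sigma_I : sigma (gelt 'F_5 1%g) = gelt 'F_5 1%g)
  (sigma_123 : sigma (gelt 'F_5 cycle123) = gelt 'F_5 cycle123)
  (sigma_132 : sigma (gelt 'F_5 cycle123^-1%g) = gelt 'F_5 cycle123^-1%g)
  (sigma_transp : forall x y : 'I_3, x != y ->
     sigma (gelt 'F_5 (tperm x y)) = - gelt 'F_5 (tperm x y))
  (C : set 'rV[{poly 'F_5}]_6)
  (C_minimal : minimal_group_conv_code sigma C)
  (C_in_Rg1 : rho_image sigma C `<=` Rg1 sigma) :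
  [/\ has_rank C 1,
      exists f : {poly 'F_5},
        [/\ encoder C (vec_plus f) \/ encoder C (vec_minus f),
            coprimep (even_part f) (odd_part f) \/
              (even_part f = 1 /\ odd_part f = 0)
          & has_complexity C (size f).-1]
    & forall f : {poly 'F_5},
        coprimep (even_part f) (odd_part f) <-> coprimep f (fneg f)].
Proof.
have sigma_t12 : sigma (gelt 'F_5 t12) = - gelt 'F_5 t12 by apply: sigma_transp.
case: C_minimal => -[[[C0 Clin] Csum] [L0 Llin] _] [Lsub L_neq0 L_indec].
pose D a b := C (blockvec a b).
have Cblock v : C v -> v = blockvec (v 0 0) (v 0 1).
  by move=> Cv; apply: (rho_Rg1 sigma); apply: C_in_Rg1; exists v.
have Drho a b : rho_image sigma C (rho sigma (blockvec a b)) -> D a b.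
  by case=> v Cv /rho_inj vE; rewrite /D -vE.
have D_lin k a b c d : D a b -> D c d -> D (k * a + c) (k * b + d).
  by move=> Dab Dcd; rewrite /D blockvec_lin; apply: (Clin k).
have D_sat k a b : k != 0 -> D (k * a) (k * b) -> D a b.
  by rewrite /D -blockvecZ; apply: summand_saturated.
have D_swap a b : D a b -> D (fneg b) (fneg a).
  move=> Dab; apply: Drho; rewrite -t12_rho_blockvec // -[_ * _]addr0.
  by apply: (Llin (skewC sigma (gelt 'F_5 t12))) => //; exists (blockvec a b).
have [Dtriv|Dall|[a [b [cop_ab Dab Dspan]]]] := saturated_plane _ D D_lin D_sat.
- (* the zero code *)
  case: L_neq0; rewrite eqEsubset; split=> [_ [v Cv <-]|_ ->] //=.
  have := Cv; rewrite (Cblock v Cv) => /Dtriv[-> ->].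
  have -> : blockvec 0 0 = 0 :> 'rV[{poly 'F_5}]_6.
    by apply/rowP=> -[[|[|[|[|[|[|//]]]]]] ?]; rewrite !mxE.
  exact: rho0.
- (* the whole plane, where e + t and e - t lie in the two eigenspaces *)
  have Lt12 (x : skewpoly sigma) : rho_image sigma C x ->
      rho_image sigma C (x * skewC sigma (gelt 'F_5 t12)).
    case=> v Cv <-; rewrite (Cblock v Cv) rho_blockvec_t12.
    by exists (blockvec (v 0 1) (v 0 0)) => //; apply: Dall.
  have Lt12K (x : skewpoly sigma) : rho_image sigma C x ->
      x * skewC sigma (gelt 'F_5 t12) * skewC sigma (gelt 'F_5 t12) = x.
    by case=> v Cv <-; rewrite (Cblock v Cv) !rho_blockvec_t12.
  have := L_indec _ _
    (involution_direct_sum _ _ _ _ (skewpoly_half sigma) Lsub Lt12 Lt12K).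
  have contra a b : a != 0 -> rho sigma (blockvec a b) = 0 -> False.
    move=> /eqP a_neq0; rewrite -(rho0 sigma) => /rho_inj/rowP/(_ 0).
    by rewrite !mxE.
  case=> [L1|L2]; exfalso.
    apply: (contra 1 1 (oner_neq0 _)).
    have : [set 0] (rho sigma (blockvec 1 1)); last by [].
    rewrite -L1 /=; split; last exact: rho_blockvec_t12.
    by exists (blockvec 1 1) => //; apply: Dall.
  apply: (contra 1 (-1) (oner_neq0 _)).
  have : [set 0] (rho sigma (blockvec 1 (-1))); last by [].
  rewrite -L2 /=; split; first by exists (blockvec 1 (-1)) => //; apply: Dall.
  by rewrite rho_blockvec_t12 -rho_blockvecN opprK.
have v_neq0 : blockvec a b != 0.
  apply/eqP => /rowP v0; move: cop_ab.
  have := v0 0; have := v0 1; rewrite !mxE /= => -> ->.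
  by rewrite /coprimep gcd0p size_poly0.
have C_v : encoder C (blockvec a b).
  apply/(encoder_row _ _ _ _ v_neq0); rewrite eqEsubset; split=> [v Cv|_ [k _ <-]].
    have := Cv; rewrite (Cblock v Cv) => /Dspan[k [-> ->]].
    by exists k; rewrite // blockvecZ.
  by rewrite -[_ *: _]addr0; apply: Clin.
have C_rank : has_rank C 1 by exists (blockvec a b).
have [k [bka akb]] := Dspan _ _ (D_swap _ _ Dab).
have b_def := fneg_swap _ _ _ cop_ab bka akb.
split=> // [|f]; last by rewrite coprimep_even_odd.
exists a; split.
- by case: b_def => bE; [left | right]; rewrite bE in C_v; exact: C_v.
- left; rewrite coprimep_even_odd.
  case: b_def => bE; move: cop_ab; rewrite bE //.
  by rewrite -scaleN1r coprimepZr // oppr_eq0 oner_eq0.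
split; first by exists 1%N.
move=> k' G CG; rewrite (encoder_rank1_minors _ _ _ _ _ _ C_v CG).
apply: max_deg_blockvec.
by case: b_def => ->; rewrite ?size_polyN size_fneg.
Qed.
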